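(* Let $A\in\mathbb{R}^{d\times d}$ be a (symmetric) positive definite matrix with eigenvalues $\lambda_1\ge\lambda_2\ge\dots\ge\lambda_d>0$, and let $l\in\mathbb{N}_+$, $l\le d$. There is an algorithm which, with high probability, finds using $\tilde{\mathcal O}(l)$ gradient oracle calls a matrix $$A_1=\sum_{i=1}^{r}a_i\,v_iv_i^{\top}\qquad (a_i\in\mathbb{R},\ v_i\in\mathbb{R}^d)$$ of rank $r=\tilde{\mathcal O}(l)$ such that $A-A_1\succeq \frac{\lambda_d}{2}I$ and $\|A-A_1\|=\mathcal O(\lambda_l)$.
   Context: The matrix $A$ is accessed through a gradient oracle: one call at $x\in\mathbb{R}^d$ returns the gradient $Ax+b$ of a quadratic $f(x)=\frac12x^\top Ax+b^\top x$ (equivalently, one matrix-vector product with $A$). $\|\cdot\|$ is the spectral norm and $\succeq$ the Loewner order. $\mathcal O(\cdot)$ hides absolute constants and $\tilde{\mathcal O}(\cdot)$ additionally hides logarithmic factors (in the dimension, the spectral quantities of $A$, and the inverse failure probability). ''With high probability'' means with probability at least $1-p$ over the internal randomness of the algorithm, for a prescribed failure probability $p\in(0,1)$. *)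

(* Defs.v *)
From HB Require Import structures.
From mathcomp Require Import all_boot all_order all_algebra.
From mathcomp Require Import all_classical all_reals all_analysis.
Set Implicit Arguments.
Unset Strict Implicit.
Unset Printing Implicit Defensive.
Import Order.TTheory GRing.Theory Num.Theory.
Local Open Scope classical_set_scope.
Local Open Scope ring_scope.

Definition quadform (R : realType) (n : nat) (M : 'M[R]_n) (x : 'cV[R]_n) : R :=
  (x^T *m M *m x) 0 0.

Definition posdefmx (R : realType) (n : nat) (M : 'M[R]_n) : Prop :=
  M \is symmetricmx /\ forall x : 'cV[R]_n, x != 0 -> 0 < quadform M x.

Definition loewner_ge (R : realType) (n : nat) (M N : 'M[R]_n) : Prop :=
  (M - N) \is symmetricmx /\ forall x : 'cV[R]_n, 0 <= quadform (M - N) x.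

Definition l2norm (R : realType) (n : nat) (x : 'cV[R]_n) : R :=
  Num.sqrt (\sum_(i < n) x i 0 ^+ 2).

(* The norm `|M| that MathComp-Analysis puts on matrices is the largest entry
   in absolute value; the spectral norm is the operator norm induced by the
   Euclidean norm. *)
Definition spectral_norm (R : realType) (n : nat) (M : 'M[R]_n) : R :=
  sup [set l2norm (M *m x) | x in [set x : 'cV[R]_n | l2norm x <= 1]].

Definition sorted_eigenvalues (R : realType) (n : nat) (M : 'M[R]_n)
    (lam : seq R) : Prop :=
  sorted (fun a b : R => b <= a) lam /\
  char_poly M = \prod_(a <- lam) ('X - a%:P).

(* The i-th largest eigenvalue, counted from i = 1. *)
Definition eig (R : realType) (lam : seq R) (i : nat) : R := nth 0 lam i.-1.

(* The gradient of x |-> 1/2 x^T A x + b^T x for a symmetric A. *)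
Definition grad_oracle (R : realType) (n : nat) (A : 'M[R]_n) (b x : 'cV[R]_n) :
  'cV[R]_n := A *m x + b.

(* A deterministic adaptive method: either it stops with an output, or it
   queries the oracle at a point and continues according to the answer.  The
   tree is well-founded, so every run stops, but after a number of calls that
   may depend on the answers. *)
Inductive oracle_alg (Q Ans Out : Type) : Type :=
| Return of Out
| Query of Q & (Ans -> oracle_alg Q Ans Out).

Fixpoint run_output (Q Ans Out : Type) (orc : Q -> Ans)
    (t : oracle_alg Q Ans Out) : Out :=
  match t with
  | Return o => o
  | Query x next => run_output orc (next (orc x))
  end.

Fixpoint run_calls (Q Ans Out : Type) (orc : Q -> Ans)
    (t : oracle_alg Q Ans Out) : nat :=
  match t with
  | Return _ => 0%N
  | Query x next => (run_calls orc (next (orc x))).+1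
  end.

(* The seed is drawn from ra_law before the first call, and all the
   randomness of the method is read off the seed. *)
Record rand_alg (R : realType) (Q Ans Out : Type) := RandAlg {
  ra_disp : measure_display;
  ra_seed : measurableType ra_disp;
  ra_law : probability ra_seed R;
  ra_strategy : ra_seed -> oracle_alg Q Ans Out
}.
Arguments ra_strategy {R Q Ans Out} alg w : rename.

(* With probability at least 1 - p, the run against the oracle orc yields an
   output o after N calls such that success o N. *)
Definition succeeds_whp (R : realType) (Q Ans Out : Type)
    (alg : rand_alg R Q Ans Out) (p : R) (orc : Q -> Ans)
    (success : Out -> nat -> Prop) : Prop :=
  exists E : set (ra_seed alg),
    [/\ measurable E,
        ((1 - p)%:E <= ra_law alg E)%E &
        forall w, E w ->
          success (run_output orc (ra_strategy alg w))
                  (run_calls orc (ra_strategy alg w))].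

(* A list of pairs (a_i, v_i) represents the sum of the a_i v_i v_i^T. *)
Definition rank1_sum (R : realType) (n : nat) (s : seq (R * 'cV[R]_n)) :
  'M[R]_n := \sum_(t <- s) t.1 *: (t.2 *m t.2^T).

(* The logarithmic factor hidden by the O-tilde notation; the summand 1 keeps
   it bounded away from 0. *)
Definition logfactor (R : realType) (d : nat) (p : R) (lam : seq R) : R :=
  1 + ln (d%:R : R) + ln p^-1 + ln (eig lam 1 / eig lam d).

(* Main.v *)
(* The algorithm runs q = O(log (d / p)) block power iterations from a random
   integer matrix G with l columns, and outputs the Nystrom approximation of A on
   X = A^q G, shifted down by theta times the orthogonal projection P onto the
   range of X, where theta is the least Rayleigh quotient of A on that range.
   For all v,
     v^T (A - A1) v = min_c (v - X c)^T A (v - X c) + theta |P v|^2.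
   Since lambda_d <= theta and min_c |v - X c|^2 = |v|^2 - |P v|^2, this is at
   least lambda_d |v|^2.  For the upper bound, theta <= lambda_l, and a coefficient
   vector c that cancels the eigencomponents of v above 2 lambda_l leaves a
   residual of energy at most 4 lambda_l |v|^2, as soon as 2^q exceeds the
   condition bound for G on the top l eigenvectors.  That bound is polynomial in
   d / p with probability 1 - p: for each column, a unit vector normal to the
   other ones has a coordinate of size at least 1 / sqrt d, along which a single
   value of the matching entry of G makes the column nearly dependent. *)
Require Import Defs.
From HB Require Import structures.
From mathcomp Require Import all_boot all_order all_algebra.
From mathcomp Require Import all_classical all_reals all_analysis.
From mathcomp Require Import ring lra.
Set Implicit Arguments.
Unset Strict Implicit.
Unset Printing Implicit Defensive.
Import Order.TTheory GRing.Theory Num.Theory.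
Local Open Scope ring_scope.

(** * Quadratic forms and the spectral norm *)

Section QuadForm.
Variable R : realType.

Definition sqnorm n (x : 'cV[R]_n) : R := \sum_(i < n) x i 0 ^+ 2.

Lemma symmetricmxP n (M : 'M[R]_n) : reflect (M^T = M) (M \is symmetricmx).
Proof.
by rewrite is_hermitianmxE expr0 scale1r map_mx_id // eq_sym; apply: eqP.
Qed.

Lemma sqnormE n (x : 'cV[R]_n) : sqnorm x = (x^T *m x) 0 0.
Proof. by rewrite mxE; apply: eq_bigr => i _; rewrite mxE expr2. Qed.

Lemma sqnorm_ge0 n (x : 'cV[R]_n) : 0 <= sqnorm x.
Proof. by apply: sumr_ge0 => i _; rewrite sqr_ge0. Qed.

Lemma sqr_le_sqnorm n (x : 'cV[R]_n) i : x i 0 ^+ 2 <= sqnorm x.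
Proof.
rewrite /sqnorm (bigD1 i) //= lerDl; apply: sumr_ge0 => j _; exact: sqr_ge0.
Qed.

Lemma sqnorm_eq0 n (x : 'cV[R]_n) : (sqnorm x == 0) = (x == 0).
Proof.
apply/eqP/eqP => [x0|->]; last first.
  by rewrite /sqnorm big1 // => i _; rewrite mxE expr0n.
apply/matrixP => i j; rewrite ord1 mxE; apply/eqP.
by rewrite -sqrf_eq0 eq_le sqr_ge0 andbT -x0 sqr_le_sqnorm.
Qed.

Lemma sqnorm_gt0 n (x : 'cV[R]_n) : (0 < sqnorm x) = (x != 0).
Proof. by rewrite lt_def sqnorm_eq0 sqnorm_ge0 andbT. Qed.

Lemma sqnormZ n a (x : 'cV[R]_n) : sqnorm (a *: x) = a ^+ 2 * sqnorm x.
Proof. by rewrite /sqnorm mulr_sumr; apply: eq_bigr => i _; rewrite mxE exprMn. Qed.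

Lemma sqnorm_isometry m n (U : 'M[R]_(m, n)) x :
  U^T *m U = 1%:M -> sqnorm (U *m x) = sqnorm x.
Proof. by move=> UU; rewrite !sqnormE trmx_mul mulmxA -(mulmxA x^T) UU mulmx1. Qed.

Lemma quadformD n (M N : 'M[R]_n) x :
  quadform (M + N) x = quadform M x + quadform N x.
Proof. by rewrite /quadform mulmxDr mulmxDl mxE. Qed.

Lemma quadformZ n a (M : 'M[R]_n) x : quadform (a *: M) x = a * quadform M x.
Proof. by rewrite /quadform -scalemxAr -scalemxAl mxE. Qed.

Lemma quadformB n (M N : 'M[R]_n) x :
  quadform (M - N) x = quadform M x - quadform N x.
Proof. by rewrite /quadform mulmxBr mulmxBl !mxE. Qed.

Lemma quadform_scalar n a (x : 'cV[R]_n) : quadform a%:M x = a * sqnorm x.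
Proof. by rewrite -scalemx1 quadformZ /quadform mulmx1 sqnormE. Qed.

Lemma quadform_congr m n (M : 'M[R]_m) (B : 'M[R]_(m, n)) x :
  quadform (B^T *m M *m B) x = quadform M (B *m x).
Proof. by rewrite /quadform trmx_mul !mulmxA. Qed.

Lemma quadform_add n (M : 'M[R]_n) x y : M^T = M ->
  quadform M (x + y) = quadform M x + (x^T *m M *m y) 0 0 *+ 2 + quadform M y.
Proof.
move=> sM; have E : (y^T *m M *m x) 0 0 = (x^T *m M *m y) 0 0.
  have -> : y^T *m M *m x = (x^T *m M *m y)^T.
    by rewrite !trmx_mul trmxK sM mulmxA.
  by rewrite mxE.
have -> : quadform M (x + y) = ((x^T + y^T) *m M *m (x + y)) 0 0.
  by congr ((_ *m _ *m _) 0 0); apply: linearD.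
rewrite !mulmxDl !mulmxDr mxE [X in X + _]mxE [X in _ + X]mxE E.
by rewrite -!/(quadform M _); ring.
Qed.

Lemma quadform_scale n (M : 'M[R]_n) a x :
  quadform M (a *: x) = a ^+ 2 * quadform M x.
Proof.
have -> : quadform M (a *: x) = ((a *: x^T) *m M *m (a *: x)) 0 0.
  by congr ((_ *m _ *m _) 0 0); apply: linearZ.
by rewrite -!scalemxAl -scalemxAr scalerA -expr2 mxE.
Qed.

Lemma quadformN n (M : 'M[R]_n) x : quadform M (- x) = quadform M x.
Proof. by rewrite -scaleN1r quadform_scale sqrrN expr1n mul1r. Qed.

Lemma posdef_unitmx n (M : 'M[R]_n) :
  (forall x, x != 0 -> 0 < quadform M x) -> M \in unitmx.
Proof.
move=> pM; rewrite unitmxE unitfE; apply/negP => /det0P[v v0 vM].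
have /pM : v^T != 0 by rewrite -(inj_eq trmx_inj) trmxK trmx0.
by rewrite /quadform trmxK vM mul0mx mxE ltxx.
Qed.

(** The quadratic polynomial [t] |-> [quadform M (x + t *: y)] is nonnegative, so its discriminant
    cannot be positive. *)
Lemma psd_cauchy_schwarz n (M : 'M[R]_n) x y : M^T = M ->
    (forall x, 0 <= quadform M x) ->
  (x^T *m M *m y) 0 0 ^+ 2 <= quadform M x * quadform M y.
Proof.
move=> sM pM; set b := (_ *m y) 0 0.
have H t : 0 <= quadform M x + t * b *+ 2 + t ^+ 2 * quadform M y.
  have := pM (x + t *: y); rewrite quadform_add // -scalemxAr mxE -/b.
  by rewrite quadform_scale.
have [y0|y0] := eqVneq (quadform M y) 0.
  have [-> //|b0] := eqVneq b 0; first by rewrite y0 mulr0 expr0n.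
  (* With no quadratic term the polynomial is affine with nonzero slope; this [t] gives it the value
     -1. *)
  have := H (- (quadform M x + 1) / (b *+ 2)); rewrite y0 mulr0 addr0.
  have -> : - (quadform M x + 1) / (b *+ 2) * b *+ 2 = - (quadform M x + 1).
    by field.
  lra.
have yp : 0 < quadform M y by rewrite lt_def y0 pM.
(* This [t] is the minimizer of the polynomial. *)
have := H (- b / quadform M y).
have -> : quadform M x + - b / quadform M y * b *+ 2
    + (- b / quadform M y) ^+ 2 * quadform M y
    = (quadform M x * quadform M y - b ^+ 2) / quadform M y by field.
by rewrite pmulr_lge0 ?invr_gt0 // subr_ge0.
Qed.

(** Cauchy-Schwarz for the form [M] at [M *m x] and [x] gives |Mx|^4 <= (K |Mx|^2) K on the unit
    ball, so |Mx| <= K without diagonalizing [M]. *)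
Lemma spectral_norm_le n (M : 'M[R]_n) K : M^T = M ->
    (forall x, 0 <= quadform M x) ->
    (forall x, quadform M x <= K * sqnorm x) -> 0 <= K ->
  spectral_norm M <= K.
Proof.
move=> sM pM uM K0; apply: ge_sup.
  exists (l2norm (M *m 0)); exists 0 => //=.
  by rewrite /l2norm big1 ?sqrtr0 // => i _; rewrite mxE expr0n.
move=> _ [x /= x1 <-]; rewrite /l2norm -/(sqnorm _).
have {}x1 : sqnorm x <= 1.
  by move: x1; rewrite /l2norm -/(sqnorm x) -{1}sqrtr1 ler_sqrt.
have h : sqnorm (M *m x) ^+ 2 <= (K * sqnorm (M *m x)) * K.
  have -> : sqnorm (M *m x) = ((M *m x)^T *m M *m x) 0 0.
    by rewrite sqnormE mulmxA.
  apply: (le_trans (psd_cauchy_schwarz _ _ sM pM)).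
  have -> : ((M *m x)^T *m M *m x) 0 0 = sqnorm (M *m x).
    by rewrite sqnormE mulmxA.
  apply: ler_pM => //; apply: (le_trans (uM _)).
  by rewrite -[leRHS]mulr1 ler_wpM2l.
have {}h : sqnorm (M *m x) <= K ^+ 2.
  have := sqnorm_ge0 (M *m x); rewrite le_eqVlt => /orP[/eqP <-|gt0].
    exact: sqr_ge0.
  rewrite -(ler_pM2l gt0); move: h; rewrite !expr2; lra.
by rewrite -[leRHS](ger0_norm K0) -sqrtr_sqr ler_wsqrtr.
Qed.

(* Completing the square in [c]. *)
Lemma quadform_nystrom n m (M : 'M[R]_n) (X : 'M[R]_(n, m)) v c :
    M^T = M -> X^T *m M *m X \in unitmx ->
  let Y := M *m X in let W := X^T *m M *m X in
  quadform M (v - X *m c) =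
    quadform (M - Y *m invmx (X^T *m Y) *m Y^T) v
    + quadform W (c - invmx W *m Y^T *m v).
Proof.
move=> sM uW Y W; have sW : W^T = W by rewrite !trmx_mul trmxK sM mulmxA.
have -> : X^T *m Y = W by rewrite mulmxA.
have YE : Y^T = X^T *m M by rewrite trmx_mul sM.
set a := Y^T *m v; set b := c^T *m a.
have eb : (v^T *m M *m (X *m c)) 0 0 = b 0 0.
  have <- : (v^T *m M *m (X *m c))^T = b by rewrite /b /a YE !trmx_mul trmxK sM !mulmxA.
  by rewrite [RHS]mxE.
have qXc : quadform M (X *m c) = quadform W c by rewrite -quadform_congr.
have e1 : quadform (Y *m invmx W *m Y^T) v = quadform (invmx W) a.
  by rewrite -quadform_congr trmxK.
have e2 : quadform W (- (invmx W *m a)) = quadform (invmx W) a.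
  by rewrite quadformN /quadform trmx_mul trmx_inv sW mulmxKV // mulmxA.
have e3 : (c^T *m W *m - (invmx W *m a)) 0 0 = - b 0 0.
  by rewrite mulmxN -(mulmxA c^T) mulKVmx // mxE.
have e4 : (v^T *m M *m - (X *m c)) 0 0 = - b 0 0 by rewrite mulmxN mxE eb.
have e5 : quadform M (- (X *m c)) = quadform W c.
  by rewrite quadformN.
rewrite quadform_add // e4 e5 quadformB e1 -mulmxA -/a quadform_add // e3 e2.
ring.
Qed.

(** Lagrange reduction: if v^T M v is nonzero, subtracting (Mv)(Mv)^T / (v^T M v) keeps [M]
    symmetric and lowers its rank. *)
Lemma rank1_decomposition n (M : 'M[R]_n) : M^T = M ->
  exists s, rank1_sum s = M /\ size s = \rank M.
Proof.
move=> sM.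
(* The reverse inequality is subadditivity of the rank, each summand having rank at most 1. *)
suff [s [sE sz]] : exists s, rank1_sum s = M /\ (size s <= \rank M)%N.
  exists s; split=> //; apply/eqP; rewrite eqn_leq sz -sE /rank1_sum.
  elim: s {sz sE} => [|t s ih]; first by rewrite big_nil mxrank0.
  rewrite big_cons /= -[(size s).+1]add1n; apply: (leq_trans (mxrank_add _ _)).
  apply: leq_add => //; apply: (leq_trans (mxrank_scale _ _)).
  by apply: (leq_trans (mxrankM_maxr _ _)); apply: rank_leq_row.
have [r] := ubnP (\rank M); elim: r => // r ih in M sM *; rewrite ltnS => rM.
have [->|M0] := eqVneq M 0.
  by exists [::]; rewrite /rank1_sum big_nil.
(* By polarization, a symmetric matrix whose form vanishes identically is zero. *)
have [v v0] : exists v, quadform M v != 0.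
  apply: contrapT => H; case/eqP: M0.
  have qd i j :
      M i j = ((delta_mx i 0 : 'cV[R]_n)^T *m M *m (delta_mx j 0 : 'cV_n)) 0 0.
    by rewrite trmx_delta -rowE -colE !mxE.
  have {}H x : quadform M x = 0.
    by apply/eqP/negPn/negP => h; apply: H; exists x.
  apply/matrixP => i j; rewrite qd [RHS]mxE.
  have := quadform_add (delta_mx i 0) (delta_mx j 0) sM.
  rewrite !H add0r addr0 => /esym/eqP; rewrite mulrn_eq0 /= => /eqP //.
set a := (quadform M v)^-1; set u := M *m v; set M' := M - a *: (u *m u^T).
have sM' : M'^T = M'.
  by rewrite linearB linearZ /= trmx_mul trmxK sM.
have M'v : M' *m v = 0.
  rewrite mulmxBl -scalemxAl -mulmxA.
  have -> : u^T *m v = (quadform M v)%:M.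
    by rewrite [LHS]mx11_scalar /quadform /u trmx_mul sM.
  by rewrite mul_mx_scalar // scalerA mulVf // scale1r subrr.
(* The row space of [M'] lies in that of [M]; equality would give [M = D *m M'], hence [M *m v = 0],
   against the choice of [v]. *)
have lt : (\rank M' < \rank M)%N.
  have sub : (M' <= M)%MS.
    by rewrite /M' /u trmx_mul sM mulmxA addmx_sub ?submx_refl // -scaleNr
      scalemx_sub // submxMl.
  rewrite (ltn_leqif (mxrank_leqif_sup sub)); apply/negP => /submxP[D DE].
  move: v0; rewrite /quadform -mulmxA DE -(mulmxA D) M'v !mulmx0 mxE.
  by rewrite eqxx.
have [s [sE sz]] := ih _ sM' (leq_trans lt rM).
exists ((a, u) :: s); rewrite /rank1_sum big_cons -/(rank1_sum s) sE /= /M' addrC subrK.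
by split=> //; apply: leq_ltn_trans lt.
Qed.
End QuadForm.

(** * Spectral theorem *)

Section Spectral.
Variable R : realType.

(** The reflection that exchanges [v] and the first basis vector e, namely I - 2 w w^T / |w|^2 with
    w = v - e; it is the identity when w = 0. *)
Lemma householder n (v : 'cV[R]_n.+1) : sqnorm v = 1 ->
  exists H : 'M[R]_n.+1, [/\ H^T = H, H *m H = 1%:M & H *m delta_mx 0 0 = v].
Proof.
move=> v1; set e : 'cV[R]_n.+1 := delta_mx 0 0.
have [ve|] := eqVneq v e.
  by exists 1%:M; rewrite trmx1 !mul1mx ve.
rewrite -subr_eq0; set w := v - e => w0.
pose b := 2 / sqnorm w; exists (1%:M - b *: (w *m w^T)).
have nz : sqnorm w != 0 by rewrite sqnorm_eq0.
have we : w^T *m e = (v 0 0 - 1)%:M.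
  by rewrite [LHS]mx11_scalar -colE 3!mxE /e !mxE.
have wnorm : sqnorm w = 2 * (1 - v 0 0).
  have -> : sqnorm w = \sum_i (v i 0 ^+ 2 + e i 0 ^+ 2 - v i 0 * e i 0 *+ 2).
    apply: eq_bigr => i _; have -> : w i 0 = v i 0 - e i 0 by rewrite 2!mxE.
    by ring.
  rewrite sumrB big_split /= -/(sqnorm v) v1.
  rewrite [\sum_i e i 0 ^+ 2](bigD1 0) //= [X in _ - X](bigD1 0) //= big1; last first.
    by move=> i i0; rewrite mxE (negPf i0) expr0n.
  rewrite big1; last by move=> i i0; rewrite mxE (negPf i0) mulr0 mul0rn.
  have -> : e 0 0 = 1 by rewrite mxE !eqxx.
  by ring.
split.
- by rewrite linearB linearZ /= trmx1 trmx_mul trmxK.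
- have ww : w^T *m w = (sqnorm w)%:M by rewrite [LHS]mx11_scalar sqnormE.
  have w4 : (w *m w^T) *m (w *m w^T) = sqnorm w *: (w *m w^T).
    by rewrite mulmxA -(mulmxA w) ww mul_mx_scalar scalemxAl.
  rewrite mulmxBl mul1mx mulmxBr mulmx1 -scalemxAl -scalemxAr w4 !scalerA.
  rewrite /b.
  have -> : 2 / sqnorm w * (2 / sqnorm w) * sqnorm w = 2 / sqnorm w + 2 / sqnorm w.
    by field.
  by rewrite scalerDl; apply/matrixP => i j; rewrite !mxE; ring.
rewrite mulmxBl mul1mx -scalemxAl -mulmxA we mul_mx_scalar scalerA.
have -> : b * (v 0 0 - 1) = -1.
  move: nz; rewrite /b wnorm => nz; field.
  by apply: contra_neq nz => ->; rewrite mulr0.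
by rewrite scaleN1r opprK /w addrC subrK.
Qed.

Lemma char_poly_conj n (A P Q : 'M[R]_n) : P *m Q = 1%:M ->
  char_poly (P *m A *m Q) = char_poly A.
Proof.
move=> PQ; rewrite /char_poly.
have -> : char_poly_mx (P *m A *m Q) =
    map_mx polyC P *m char_poly_mx A *m map_mx polyC Q.
  rewrite /char_poly_mx mulmxBr mulmxBl -!map_mxM; congr (_ - _).
  by rewrite scalar_mxC -mulmxA -map_mxM PQ map_mx1 mulmx1.
by rewrite !det_mulmx mulrAC -det_mulmx -map_mxM PQ map_mx1 det1 mul1r.
Qed.

(** Deflation: a Householder reflection sends e_0 to a unit eigenvector for the head of [lam], and
    the conjugated matrix splits off a 1 x 1 block. Since the splitting of the characteristic
    polynomial is given, the eigenvalues come out in the order of [lam]. *)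
Lemma spectral_theorem n (A : 'M[R]_n) lam : A^T = A ->
    char_poly A = \prod_(a <- lam) ('X - a%:P) ->
  exists V : 'M[R]_n, V^T *m V = 1%:M /\
    A = V *m diag_mx (\row_i lam`_i) *m V^T.
Proof.
elim: n A lam => [|n ih] A lam sA cA.
  by exists 1%:M; split; apply/matrixP => -[].
have : size (char_poly A) = n.+2 by rewrite size_char_poly.
rewrite cA size_prod_XsubC; case: lam cA => [//|a lam] cA _.
have [v vA v0] : exists2 v : 'rV_n.+1, v *m A = a *: v & v != 0.
  by apply/eigenvalueP; rewrite eigenvalue_root_char cA root_prod_XsubC mem_head.
pose u := (Num.sqrt (sqnorm v^T))^-1 *: v^T.
have v1 : 0 < sqnorm v^T by rewrite sqnorm_gt0 -(inj_eq trmx_inj) trmxK trmx0.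
have /householder[H [sH HH He]] : sqnorm u = 1.
  by rewrite sqnormZ exprVn sqr_sqrtr ?ltW // mulVf // gt_eqF.
have Au : A *m u = a *: u.
  by rewrite -scalemxAr -[A *m _]trmxK trmx_mul trmxK sA vA linearZ /= !scalerA mulrC.
have [B BD] : exists B : 'M[R]_(1 + n), B = H *m A *m H by exists (H *m A *m H).
have sB : B^T = B by rewrite BD !trmx_mul sH sA mulmxA.
have B1 : B *m (delta_mx 0 0 : 'cV_(1 + n)) = a *: delta_mx 0 0.
  rewrite BD -!mulmxA He Au -scalemxAr; congr (_ *: _).
  by rewrite -He mulmxA HH mul1mx.
have B1' i : B i 0 = a * (i == 0)%:R.
  by move/matrixP/(_ i 0): B1; rewrite -colE !mxE eqxx andbT.
have BE : B = block_mx (a%:M : 'M[R]_1) 0 0 (drsubmx B).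
  rewrite -[LHS]submxK; congr block_mx.
  - apply/matrixP => i j; rewrite !ord1 !mxE.
    have -> : lshift n (0 : 'I_1) = 0 by apply: val_inj.
    by rewrite B1' !eqxx mulr1.
  - apply/matrixP => i j; rewrite !ord1 -sB !mxE.
    have -> : lshift n (0 : 'I_1) = 0 by apply: val_inj.
    by rewrite B1' mulr0.
  - apply/matrixP => i j; rewrite !ord1 !mxE.
    have -> : lshift n (0 : 'I_1) = 0 by apply: val_inj.
    by rewrite B1' mulr0.
set A' := drsubmx B in BE.
have sA' : A'^T = A' by rewrite /A' trmx_drsub sB.
have [|V' [VV' A'E]] := ih A' lam sA'.
  (* Cancelling the factor of the split-off block shows that the tail of [lam] is the spectrum of
     [A']. *)
  have : char_poly B = ('X - a%:P) * \prod_(a <- lam) ('X - a%:P).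
    by rewrite BD char_poly_conj // cA big_cons.
  rewrite BE /char_poly char_block_diag_mx det_ublock -!/(char_poly _).
  rewrite {1}/char_poly det_mx11 !mxE eqxx mulr1n => /mulfI; apply.
  by rewrite polyXsubC_eq0.
pose W : 'M[R]_(1 + n) := block_mx 1%:M 0 0 V'.
have WT : W^T = block_mx 1%:M 0 0 V'^T by rewrite tr_block_mx !trmx0 trmx1.
have WW : W^T *m W = 1%:M.
  rewrite WT /W mulmx_block.
  by rewrite !mulmx0 !mul0mx mulmx1 !addr0 add0r VV' -scalar_mx_block.
have BV : B = W *m diag_mx (\row_i (a :: lam)`_i) *m W^T.
  have -> : \row_i (a :: lam)`_i = row_mx (a%:M : 'M[R]_1) (\row_i lam`_i) :> 'rV_(1 + n).
    apply/matrixP => i j; rewrite !ord1; case: (split_ordP j) => k ->.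
      by rewrite row_mxEl !mxE !ord1.
    by rewrite row_mxEr !mxE.
  have a1 : diag_mx (a%:M : 'M[R]_1) = a%:M.
    by apply/matrixP => i j; rewrite !ord1 !mxE.
  rewrite diag_mx_row a1 WT /W !mulmx_block.
  by rewrite !(mulmx0, mul0mx, mulmx1, mul1mx, addr0, add0r) -A'E -BE.
have AE : A = H *m B *m H.
  by rewrite BD !mulmxA HH mul1mx -mulmxA HH mulmx1.
exists (H *m W); split.
  rewrite trmx_mul sH mulmxA -(mulmxA W^T H) HH mulmx1; exact: WW.
by rewrite {1}AE BV trmx_mul sH !mulmxA.
Qed.
End Spectral.

(** * Conditioning of random integer matrices *)

Section RandomMatrix.
Variable R : realType.

Lemma cauchy_schwarz n (x y : 'cV[R]_n) :
  (x^T *m y) 0 0 ^+ 2 <= sqnorm x * sqnorm y.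
Proof.
have := @psd_cauchy_schwarz R n 1%:M x y (trmx1 _ _).
rewrite !quadform_scalar !mul1r mulmx1; apply => z.
by rewrite quadform_scalar mul1r sqnorm_ge0.
Qed.

Lemma cauchy_schwarz_sum n (x y : 'I_n -> R) :
  (\sum_i x i * y i) ^+ 2 <= (\sum_i x i ^+ 2) * (\sum_i y i ^+ 2).
Proof.
have := cauchy_schwarz (\col_i x i) (\col_i y i).
rewrite /sqnorm mxE; under eq_bigr do rewrite !mxE.
under [X in _ <= X * _]eq_bigr do rewrite !mxE.
by under [X in _ <= _ * X]eq_bigr do rewrite !mxE.
Qed.

Lemma sqnorm_tr_isometry m n (U : 'M[R]_(m, n)) (u : 'rV[R]_m) :
  U *m U^T = 1%:M -> sqnorm (u *m U)^T = sqnorm u^T.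
Proof. by move=> UU; rewrite trmx_mul sqnorm_isometry ?trmxK. Qed.

Lemma max_coordinate n (x : 'cV[R]_n) : x != 0 ->
  exists i, sqnorm x <= n%:R * x i 0 ^+ 2.
Proof.
move=> x0; apply: contrapT => H.
have {}H i : n%:R * x i 0 ^+ 2 < sqnorm x.
  by rewrite ltNge; apply/negP => h; apply: H; exists i.
case: n x x0 H => [|n] x x0 H.
  by case/eqP: x0; apply/matrixP => -[].
have : \sum_(i < n.+1) n.+1%:R * x i 0 ^+ 2 < \sum_(i < n.+1) sqnorm x.
  by apply: ltr_sum => //; apply/hasP; exists 0; rewrite ?mem_index_enum.
by rewrite -mulr_sumr sumr_const card_ord -[ltRHS]mulr_natl -/(sqnorm x) ltxx.
Qed.

(** Erasing the column instead of deleting it keeps the format, so a choice made from this matrix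
    depends on the other columns only. *)
Definition zero_col m n (i : 'I_n) (M : 'M[R]_(m, n)) : 'M[R]_(m, n) :=
  \matrix_(s, j) if j == i then 0 else M s j.

Definition natmx m n N (G : {ffun 'I_m * 'I_n -> 'I_N}) : 'M[R]_(m, n) :=
  \matrix_(s, j) (G (s, j))%:R.

(** [U *m zero_col i M] has a zero column, hence a nonzero left kernel vector u. As u |-> u U is
    isometric, some coordinate of u U carries at least 1/d of the squared norm. *)
Lemma normal_of_other_cols l d (U : 'M[R]_(l, d)) (i : 'I_l) (M : 'M[R]_(d, l)) :
    U *m U^T = 1%:M ->
  exists ut : 'rV[R]_l * 'I_d,
    [/\ ut.1 != 0,
        forall j, j != i -> (ut.1 *m U *m M) 0 j = 0 &
        sqnorm ut.1^T <= d%:R * (ut.1 *m U) 0 ut.2 ^+ 2].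
Proof.
move=> UU.
have /eqP/det0P[u u0 uH] : \det (U *m zero_col i M) = 0.
  rewrite -det_tr (expand_det_row _ i) big1 // => j _.
  by rewrite !mxE big1 ?mul0r // => k _; rewrite !mxE eqxx mulr0.
have /max_coordinate[t ht] : (u *m U)^T != 0.
  by rewrite -sqnorm_eq0 sqnorm_tr_isometry // sqnorm_eq0 -(inj_eq trmx_inj) trmxK trmx0.
exists (u, t); split=> //= [j ji|].
  move/matrixP/(_ 0 j): uH; rewrite mulmxA mxE [RHS]mxE => uH; rewrite mxE -[RHS]uH.
  by apply: eq_bigr => k _; rewrite [zero_col _ _ _ _]mxE (negPf ji).
by rewrite mxE sqnorm_tr_isometry // in ht.
Qed.

Lemma sqr_natr_dist (m n : nat) : m != n -> 1 <= (m%:R - n%:R : R) ^+ 2.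
Proof.
wlog mn : m n / (n < m)%N => [H|_].
  rewrite neq_ltn => /orP[mn|nm]; last by apply: H; rewrite ?gtn_eqF.
  by rewrite -sqrrN opprB; apply: H; rewrite ?gtn_eqF.
by rewrite -natrB 1?ltnW // -natrX ler1n expn_gt0 subn_gt0 mn.
Qed.

(* Once the entries of [G] off the position [(t, i)] are fixed, the normal [u]
   is fixed and the pairing of [u *m U] with column [i] is an affine function of
   the remaining entry whose values are at least [|u| / sqrt d] apart. *)
Lemma card_bad_col l d N (U : 'M[R]_(l, d)) (i : 'I_l)
    (f : 'M[R]_(d, l) -> 'rV[R]_l * 'I_d)
    (y : {ffun 'I_d * 'I_l -> 'I_N} -> 'rV[R]_l) :
    (forall G, y G = (f (zero_col i (natmx G))).1) ->
    (forall M, sqnorm (f M).1^T <= d%:R * ((f M).1 *m U) 0 (f M).2 ^+ 2) ->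
  (#|[set G | ((4 * d)%:R * (y G *m U *m natmx G) 0 i ^+ 2 < sqnorm (y G)^T)%R]| * N
    <= #|{ffun 'I_d * 'I_l -> 'I_N}|)%N.
Proof.
move=> yE hf; set S := [set G | _].
pose pos (G : {ffun 'I_d * 'I_l -> 'I_N}) := ((f (zero_col i (natmx G))).2, i).
(* Overwriting the sensitive entry of a bad [G] by an arbitrary value is injective on pairs (bad
   [G], value), which gives the count. *)
pose phi (Ga : {ffun 'I_d * 'I_l -> 'I_N} * 'I_N) :=
  [ffun x => if x == pos Ga.1 then Ga.2 else Ga.1 x].
have phi_col Ga : zero_col i (natmx (phi Ga)) = zero_col i (natmx Ga.1).
  apply/matrixP => s j; rewrite !mxE; case: eqP => // /eqP ji.
  by rewrite ffunE /pos xpair_eqE (negPf ji) andbF.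
have phi_inj : {in finset.setX S [set: 'I_N] &, injective phi}.
  move=> [G a] [G' a']; rewrite !finset.in_setX !inE !andbT /= => GS GS' e.
  have Z : zero_col i (natmx G) = zero_col i (natmx G').
    by rewrite -(phi_col (G, a)) e phi_col.
  have P : pos G = pos G' by rewrite /pos Z.
  have aa' : a = a'.
    by move/ffunP/(_ (pos G)): (e); rewrite !ffunE /= -P eqxx.
  have off x : x != pos G -> G x = G' x.
    move=> xP; move/ffunP/(_ x): (e); rewrite !ffunE /= -P.
    by rewrite (negPf xP).
  congr (_, _) => //; apply/ffunP => x.
  have [->|/off //] := eqVneq x (pos G).
  apply/eqP/negP => /negP ne.
  move: GS GS'; rewrite !yE -Z; set M := zero_col i (natmx G).
  set u := (f M).1; set t := (f M).2; have := hf M; rewrite -/u -/t => ht GS GS'.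
  have : (u *m U *m natmx G) 0 i - (u *m U *m natmx G') 0 i =
      (u *m U) 0 t * ((G (t, i))%:R - (G' (t, i))%:R).
    rewrite [X in X - _]mxE [X in _ - X]mxE -sumrB (bigD1 t) //= big1 ?addr0.
      by rewrite !mxE -mulrBr.
    move=> s st; rewrite [natmx G s i]mxE [natmx G' s i]mxE off ?subrr //.
    by rewrite /pos xpair_eqE (negPf st).
  set al := (_ *m natmx G) 0 i in GS *; set be := (_ *m natmx G') 0 i in GS' *.
  set z := _ 0 t in ht *; set g := (X in _ = z * X) => ez.
  have g1 : 1 <= g ^+ 2.
    by apply: sqr_natr_dist; apply: contra ne => /eqP/val_inj ->.
  have d0 : 0 <= d%:R :> R by [].
  (* Two bad values would give 2d (al^2 + be^2) < |u|^2 <= d z^2 <= d (al - be)^2, against the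
     parallelogram law. *)
  have : d%:R * z ^+ 2 <= d%:R * (z * g) ^+ 2.
    rewrite ler_wpM2l // exprMn -[leLHS]mulr1 ler_wpM2l ?sqr_ge0 //.
  rewrite -ez; have := mulr_ge0 d0 (sqr_ge0 (al + be)).
  move: ht GS GS'; rewrite natrM; clear; nra.
rewrite -[N in (_ * N)%N]card_ord -cardsT -cardsX -(card_in_imset phi_inj).
exact: max_card.
Qed.

(** Union bound over the columns. Off the bad set, the normals [y i G] act as a dual basis for the
    columns of [H = U *m G]: each isolates one coordinate of [c] from [H *m c]. *)
Lemma random_cols_well_conditioned l d N (U : 'M[R]_(l, d)) : U *m U^T = 1%:M ->
  exists B : {set {ffun 'I_d * 'I_l -> 'I_N}},
    (#|B| * N <= l * #|{ffun 'I_d * 'I_l -> 'I_N}|)%N /\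
    forall G, G \notin B -> forall w : 'cV[R]_l, exists c : 'cV[R]_l,
      U *m natmx G *m c = w /\
      sqnorm (natmx G *m c) <= (2 * d * l * N)%:R ^+ 2 * sqnorm w.
Proof.
move=> UU.
have /boolp.choice[f hf] (iM : 'I_l * 'M[R]_(d, l)) :
    exists ut : 'rV[R]_l * 'I_d, [/\ ut.1 != 0,
      forall j, j != iM.1 -> (ut.1 *m U *m iM.2) 0 j = 0 &
      sqnorm ut.1^T <= d%:R * (ut.1 *m U) 0 ut.2 ^+ 2].
  exact: normal_of_other_cols.
pose y i (G : {ffun 'I_d * 'I_l -> 'I_N}) := (f (i, zero_col i (natmx G))).1.
pose Bi i := [set G | (4 * d)%:R * (y i G *m U *m natmx G) 0 i ^+ 2
   < sqnorm (y i G)^T].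
exists (\bigcup_i Bi i); split.
  apply: (@leq_trans ((\sum_i #|Bi i|) * N)).
    rewrite leq_mul2r; apply/orP; right.
    by apply: (big_ind2 (fun (A : {set _}) n => (#|A| <= n)%N));
      rewrite ?cards0 // => A a B b Aa Bb;
      apply: (leq_trans (leq_card_setU _ _)); apply: leq_add.
  rewrite big_distrl /= -[l in (l * _)%N]card_ord -sum_nat_const.
  apply: leq_sum => i _.
  apply: (@card_bad_col _ _ _ _ _ (fun M => f (i, M))) => // M.
  by have [] := hf (i, M).
move=> G GB w; set M := natmx G; set H := U *m M.
have good i : sqnorm (y i G)^T <= (4 * d)%:R * (y i G *m H) 0 i ^+ 2.
  rewrite leNgt; apply: contra GB => h; apply/bigcupP; exists i => //.
  by rewrite inE -mulmxA.
have orth i j : j != i -> (y i G *m H) 0 j = 0.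
  move=> ji; have [_ /(_ j ji) h _] := hf (i, zero_col i (natmx G)).
  rewrite -[RHS]h -/(y i G) /H mulmxA mxE [RHS]mxE; apply: eq_bigr => k _.
  by rewrite [zero_col _ _ _ _]mxE (negPf ji).
have y0 i : y i G != 0 by have [] := hf (i, zero_col i (natmx G)).
have sy i : 0 < sqnorm (y i G)^T.
  by rewrite sqnorm_gt0 -(inj_eq trmx_inj) trmxK trmx0.
have yc i (c : 'cV[R]_l) : (y i G *m (H *m c)) 0 0 = (y i G *m H) 0 i * c i 0.
  rewrite mulmxA mxE (bigD1 i) //= big1 ?addr0 // => j ji.
  by rewrite orth // mul0r.
(* Pairing [H *m c] with the i-th normal leaves (y_i H)_i c_i; its first factor is bounded below by
   goodness, and the pairing is bounded above by Cauchy-Schwarz. *)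
have cb i (c : 'cV[R]_l) : c i 0 ^+ 2 <= (4 * d)%:R * sqnorm (H *m c).
  rewrite -(ler_pM2l (sy i)).
  apply: (@le_trans _ _ ((4 * d)%:R * (y i G *m (H *m c)) 0 0 ^+ 2)).
    by rewrite yc exprMn [leRHS]mulrA ler_wpM2r ?sqr_ge0 ?good.
  rewrite [leRHS]mulrCA ler_wpM2l //.
  by rewrite -[y i G in leLHS]trmxK; apply: cauchy_schwarz.
have Hu : H \in unitmx.
  rewrite -unitmx_tr unitmxE unitfE; apply/negP => /det0P[v v0 vH].
  case/eqP: v0; apply: trmx_inj; rewrite trmx0; apply/matrixP => i j.
  rewrite ord1 [RHS]mxE; apply/eqP; rewrite -sqrf_eq0 eq_le sqr_ge0 andbT.
  apply: (le_trans (cb i v^T)).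
  have -> : H *m v^T = 0 by rewrite -[H]trmxK -trmx_mul vH trmx0.
  have /eqP -> : sqnorm (0 : 'cV[R]_l) == 0 by rewrite sqnorm_eq0.
  by rewrite mulr0.
exists (invmx H *m w); split; first by rewrite mulKVmx.
set c := _ *m w; have Hc : H *m c = w by rewrite mulKVmx.
have sc : \sum_j c j 0 ^+ 2 <= l%:R * ((4 * d)%:R * sqnorm w).
  rewrite -Hc mulr_natl -[l in _ *+ l]card_ord -sumr_const.
  by apply: ler_sum => j _; apply: cb.
(* Each of the [d] rows contributes at most l N^2 |c|^2 with |c|^2 <= 4 d l |w|^2, a total of (2 d l
   N)^2 |w|^2. *)
have -> : (2 * d * l * N)%:R ^+ 2 * sqnorm w =
    \sum_(t < d) l%:R * N%:R ^+ 2 * (l%:R * ((4 * d)%:R * sqnorm w)).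
  by rewrite sumr_const card_ord -mulr_natl !natrM; ring.
apply: ler_sum => t _; rewrite mxE.
apply: (le_trans (cauchy_schwarz_sum _ _)); apply: ler_pM => //.
- by apply: sumr_ge0 => j _; rewrite sqr_ge0.
- by apply: sumr_ge0 => j _; rewrite sqr_ge0.
rewrite mulr_natl -[l in _ *+ l]card_ord -sumr_const.
apply: ler_sum => j _; rewrite mxE lerXn2r ?nnegrE // ler_nat.
exact: ltnW.
Qed.
End RandomMatrix.

(** * Shifted Nystrom approximation after power iteration *)

Section Approximation.
Local Open Scope classical_set_scope.
Local Open Scope ring_scope.
Variable R : realType.

(** With [Y = A *m X] this is the Nystrom approximation of [A] on the range of [X]; with [Y = X] it
    is the orthogonal projection onto that range, for injective [X]. Taking [Y] as an argument lets
    the output be computed from oracle answers alone. *)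
Definition nystrom n m (X Y : 'M[R]_(n, m)) : 'M[R]_n :=
  Y *m invmx (X^T *m Y) *m Y^T.

Definition min_ritz n m (X Y : 'M[R]_(n, m)) : R :=
  inf [set quadform (X^T *m Y) c / sqnorm (X *m c) | c in [set c | c != 0]].

(* The shift adds [min_ritz X Y] times the orthogonal projection onto the range
   of [X] to the residual, which is exactly where the Nystrom residual vanishes. *)
Definition shifted_nystrom n m (X Y : 'M[R]_(n, m)) : 'M[R]_n :=
  nystrom X Y - min_ritz X Y *: nystrom X X.

Lemma rank_shifted_nystrom n m (X Y : 'M[R]_(n, m)) :
  (\rank (shifted_nystrom X Y) <= 2 * m)%N.
Proof.
have rk Z : (\rank (nystrom X Z) <= m)%N.
  exact: (leq_trans (mxrankM_maxr _ _) (rank_leq_row _)).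
rewrite mul2n -addnn; apply: (leq_trans (mxrank_add _ _)); apply: leq_add => //.
by rewrite mxrank_opp; apply: (leq_trans (mxrank_scale _ _)).
Qed.

Lemma quadform0 n (M : 'M[R]_n) : quadform M 0 = 0.
Proof. by rewrite /quadform mulmx0 mxE. Qed.

(** In the completed square the term in [c] is positive semidefinite and vanishes at an explicit
    [c], so the Nystrom residual is a minimum over the range of [X]. *)
Lemma nystrom_min n m (M : 'M[R]_n) (X : 'M[R]_(n, m)) v : M^T = M ->
    (forall c, c != 0 -> 0 < quadform (X^T *m M *m X) c) ->
  let N := M - nystrom X (M *m X) in
  (exists c, quadform M (v - X *m c) = quadform N v) /\
  (forall c, quadform N v <= quadform M (v - X *m c)).
Proof.
move=> sM pW; have uW := posdef_unitmx pW; split=> [|c].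
  exists (invmx (X^T *m M *m X) *m (M *m X)^T *m v).
  by rewrite quadform_nystrom // subrr quadform0 addr0.
rewrite quadform_nystrom // lerDl.
by set z := _ - _; have [->|/pW/ltW//] := eqVneq z 0; rewrite quadform0.
Qed.

Lemma tr_nystrom n m (X Y : 'M[R]_(n, m)) : (X^T *m Y)^T = X^T *m Y ->
  (nystrom X Y)^T = nystrom X Y.
Proof. by move=> s; rewrite !trmx_mul trmxK trmx_inv s mulmxA. Qed.

(** The least Ritz value [th] lies between [mu] and [nu]. The factor 5 is 4 from the Nystrom
    residual plus 1 from the shift. *)
Lemma shifted_nystrom_bounds n m (A : 'M[R]_n) (X : 'M[R]_(n, m)) (mu nu : R) :
    let E := A - shifted_nystrom X (A *m X) in
    A^T = A -> 0 < mu -> (forall x, mu * sqnorm x <= quadform A x) ->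
    (forall c : 'cV[R]_m, X *m c = 0 -> c = 0) ->
    (exists2 c, c != 0 & quadform A (X *m c) <= nu * sqnorm (X *m c)) ->
    (forall v, exists c, quadform A (v - X *m c) <= 4 * nu * sqnorm v) ->
  [/\ E^T = E, forall v, mu * sqnorm v <= quadform E v &
      forall v, quadform E v <= 5 * nu * sqnorm v].
Proof.
move=> E sA mu0 hmu injX [c0 c00 hc0] happ.
have Xpos c : c != 0 -> 0 < sqnorm (X *m c).
  by rewrite sqnorm_gt0; apply: contra_neq => /injX.
have qA c : quadform (X^T *m A *m X) c = quadform A (X *m c).
  exact: quadform_congr.
have q1 c : quadform (X^T *m 1%:M *m X) c = sqnorm (X *m c).
  by rewrite quadform_congr quadform_scalar mul1r.
have WA c : c != 0 -> 0 < quadform (X^T *m A *m X) c.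
  move=> /Xpos c1; rewrite qA; apply: lt_le_trans (hmu _).
  exact: mulr_gt0.
have W1 c : c != 0 -> 0 < quadform (X^T *m 1%:M *m X) c.
  by move=> /Xpos; rewrite q1.
pose S := [set quadform (X^T *m (A *m X)) c / sqnorm (X *m c) | c in [set c | c != 0]].
have Slb : lbound S mu.
  move=> _ [c /= /Xpos c1 <-]; rewrite mulmxA qA ler_pdivlMr //.
have SE : S !=set0.
  by exists (quadform (X^T *m (A *m X)) c0 / sqnorm (X *m c0)); exists c0.
have th1 : mu <= min_ritz X (A *m X) by apply: lb_le_inf.
have th2 : min_ritz X (A *m X) <= nu.
  apply: (@le_trans _ _ (quadform (X^T *m (A *m X)) c0 / sqnorm (X *m c0))).
    by apply: ge_inf; [exists mu|exists c0].
  by rewrite mulmxA qA ler_pdivrMr ?Xpos.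
set th := min_ritz _ _ in th1 th2 *.
have sN : (nystrom X (A *m X))^T = nystrom X (A *m X).
  by apply: tr_nystrom; rewrite !trmx_mul trmxK sA mulmxA.
have sP : (nystrom X X)^T = nystrom X X.
  by apply: tr_nystrom; rewrite trmx_mul trmxK.
have EE : E = (A - nystrom X (A *m X)) + th *: (1%:M - (1%:M - nystrom X X)).
  by rewrite /E /shifted_nystrom subKr opprB addrA addrAC.
have ET : E^T = E.
  by rewrite /E /shifted_nystrom !linearB linearZ /= sA sN sP.
(* Here [e] is the squared distance from [v] to the range of [X]. Comparing with the point 0 of the
   range bounds [e] by |v|^2; comparing with the [A]-optimal point bounds [mu * e] by the
   residual. *)
have key v : exists e, [/\ 0 <= e, e <= sqnorm v,
    quadform E v = quadform (A - nystrom X (A *m X)) v + th * (sqnorm v - e) &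
    mu * e <= quadform (A - nystrom X (A *m X)) v].
  have [[c hc] _] := nystrom_min v sA WA.
  have [[c1 hc1] hP] := nystrom_min v (trmx1 _ _) W1.
  rewrite mul1mx in hc1 hP.
  exists (quadform (1%:M - nystrom X X) v); split.
  - by rewrite -hc1 quadform_scalar mul1r sqnorm_ge0.
  - by apply: (le_trans (hP 0)); rewrite mulmx0 subr0 quadform_scalar mul1r.
  - rewrite EE quadformD quadformZ [quadform (1%:M - _) v]quadformB.
    by rewrite quadform_scalar mul1r.
  - rewrite -hc; apply: le_trans (hmu _); rewrite ler_pM2l //.
    by apply: (le_trans (hP c)); rewrite quadform_scalar mul1r.
split=> // v; have [e [e0 e1 -> e2]] := key v; have sv := sqnorm_ge0 v.
  have : 0 <= (th - mu) * (sqnorm v - e) by rewrite mulr_ge0 ?subr_ge0.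
  nra.
have [c hc] := happ v; have [_ /(_ c) hm] := nystrom_min v sA WA.
have : 0 <= th * e by rewrite mulr_ge0 // (le_trans (ltW mu0)).
have : 0 <= (nu - th) * sqnorm v by rewrite mulr_ge0 ?subr_ge0.
nra.
Qed.

Lemma lerX_sqr q (x y : R) : 0 <= x -> x <= y -> x ^+ q ^+ 2 <= y ^+ q ^+ 2.
Proof.
by move=> x0 xy; rewrite !lerXn2r ?nnegrE ?exprn_ge0 ?(le_trans x0).
Qed.

(** * Block power iteration in eigencoordinates *)

Section PowerIteration.
Variables (d l : nat) (A V : 'M[R]_d) (lm : 'I_d -> R) (ll : R).
Hypothesis VV : V^T *m V = 1%:M.
Hypothesis AE : A = V *m diag_mx (\row_i lm i) *m V^T.
Hypothesis lm_gt0 : forall i, 0 < lm i.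
Hypothesis ll_gt0 : 0 < ll.
Hypothesis ld : (l <= d)%N.
Hypothesis lm_bot : forall i : 'I_d, (l <= i)%N -> lm i <= ll.

Definition top_rows : 'M[R]_(l, d) := \matrix_(i, j) V j (widen_ord ld i).

Lemma mulmx_tr_basis : V *m V^T = 1%:M.
Proof. exact: mulmx1C. Qed.

Lemma top_rows_isometry : top_rows *m top_rows^T = 1%:M.
Proof.
apply/matrixP => i j.
move/matrixP/(_ (widen_ord ld i) (widen_ord ld j)): VV; rewrite !mxE => <-.
by apply: eq_bigr => k _; rewrite !mxE.
Qed.

Lemma top_rowsE m (x : 'M[R]_(d, m)) i j :
  (top_rows *m x) i j = (V^T *m x) (widen_ord ld i) j.
Proof. by rewrite !mxE; apply: eq_bigr => k _; rewrite !mxE. Qed.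

Lemma quadform_diag x : quadform A x = \sum_i lm i * (V^T *m x) i 0 ^+ 2.
Proof.
have -> : quadform A x = quadform (diag_mx (\row_i lm i)) (V^T *m x).
  by rewrite -quadform_congr trmxK -AE.
rewrite /quadform mxE; apply: eq_bigr => i _.
rewrite mul_mx_diag !mxE; ring.
Qed.

Lemma sqnorm_coord x : sqnorm x = \sum_i (V^T *m x) i 0 ^+ 2.
Proof. by rewrite -[LHS](sqnorm_isometry (U := V^T)) ?trmxK ?mulmx_tr_basis. Qed.

Lemma iter_mulmx_coord q m (G : 'M[R]_(d, m)) i j :
  (V^T *m iter q (mulmx A) G) i j = lm i ^+ q * (V^T *m G) i j.
Proof.
elim: q => [|q ih]; first by rewrite mul1r.
rewrite iterS {1}AE !mulmxA VV mul1mx -mulmxA mul_diag_mx mxE ih mxE.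
by rewrite exprS mulrA.
Qed.

Variables (q K : nat) (G : 'M[R]_(d, l)).
Hypothesis Kq : (K <= 2 ^ q)%N.
Hypothesis good : forall w : 'cV[R]_l, exists c : 'cV[R]_l,
  top_rows *m G *m c = w /\ sqnorm (G *m c) <= K%:R ^+ 2 * sqnorm w.

Let X := iter q (mulmx A) G.

Lemma iter_mulmx_vec (c : 'cV[R]_l) i :
  (V^T *m (X *m c)) i 0 = lm i ^+ q * (V^T *m (G *m c)) i 0.
Proof.
rewrite !mulmxA mxE [in RHS]mxE mulr_sumr; apply: eq_bigr => j _.
by rewrite iter_mulmx_coord mulrA.
Qed.

(** Solving [good] for the basis vectors gives a right inverse of the square matrix [top_rows *m G].
    Power iteration multiplies the top coordinates of [G *m c] by positive numbers, so they vanish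
    with [X *m c]. *)
Lemma power_iteration_inj (c : 'cV[R]_l) : X *m c = 0 -> c = 0.
Proof.
move=> Xc.
have [H HH] : exists H, top_rows *m G *m H = 1%:M.
  have [f hf] := boolp.choice good.
  exists (\matrix_(i, j) f (delta_mx j 0) i 0); apply/matrixP => i j.
  have [/matrixP/(_ i 0) e _] := hf (delta_mx j 0).
  rewrite [RHS]mxE; rewrite [X in _ = X]mxE eqxx andbT in e; rewrite -e [LHS]mxE mxE.
  by apply: eq_bigr => k _; rewrite [X in _ * X = _]mxE.
have uG : top_rows *m G \in unitmx by case/mulmx1_unit: HH.
rewrite -[c](mulKmx uG); suff -> : top_rows *m G *m c = 0 by rewrite mulmx0.
apply/matrixP => i j; rewrite ord1 -mulmxA top_rowsE [RHS]mxE.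
have := iter_mulmx_vec c (widen_ord ld i); rewrite Xc mulmx0 mxE => /esym/eqP.
by rewrite mulf_eq0 expf_eq0 gt_eqF //= andbF => /eqP.
Qed.

(** Choosing [c] so that the only top coordinate of [G *m c] is the one at [i0] leaves in [X *m c]
    only components with eigenvalue at most [ll]. *)
Lemma power_iteration_ritz (i0 : 'I_l) : lm (widen_ord ld i0) = ll ->
  exists2 c, c != 0 & quadform A (X *m c) <= ll * sqnorm (X *m c).
Proof.
move=> lm0; have [c [hc _]] := good (delta_mx i0 0).
exists c.
  apply: contra_eq_neq hc => ->; rewrite mulmx0 eq_sym.
  by apply/eqP => /matrixP/(_ i0 0)/eqP; rewrite !mxE !eqxx oner_eq0.
rewrite quadform_diag sqnorm_coord mulr_sumr; apply: ler_sum => i _.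
rewrite iter_mulmx_vec; case: (ltnP i l) => il; last first.
  by rewrite ler_wpM2r ?sqr_ge0 // lm_bot.
have -> : i = widen_ord ld (Ordinal il) by apply: val_inj.
rewrite -top_rowsE mulmxA hc mxE eqxx andbT.
have [->|_] := eqVneq; first by rewrite lm0.
by rewrite mulr0 expr0n /= !mulr0.
Qed.

(* Only the components with [lm i > 2 * ll] are matched; the others, of size at
   most [2 * ll], are left in the residual, so that no spectral gap is needed for
   [c] to have norm [O((2 * ll) ^- q)]. *)
Lemma power_iteration_approx (v : 'cV[R]_d) :
  exists c, quadform A (v - X *m c) <= 4 * ll * sqnorm v.
Proof.
(* Dividing by [lm j ^+ q] compensates the scaling of coordinate [j] under [q] iterations. *)
pose w : 'cV[R]_l := \col_i (let j := widen_ord ld i in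
  if 2 * ll < lm j then (lm j ^+ q)^-1 * (V^T *m v) j 0 else 0).
have ll2 : 0 < 2 * ll by rewrite mulr_gt0.
have sw : (2 * ll) ^+ q ^+ 2 * sqnorm w <= sqnorm v.
  rewrite sqnorm_coord (bigID (fun i : 'I_d => (i < l)%N)) /=.
  rewrite (big_ord_narrow ld) /= mulr_sumr.
  rewrite -[leLHS]addr0; apply: lerD; last by apply: sumr_ge0 => i _; exact: sqr_ge0.
  apply: ler_sum => i _; rewrite mxE /=; case: ifP => h; last first.
    by rewrite expr0n mulr0 sqr_ge0.
  have p0 : 0 < lm (widen_ord ld i) ^+ q by rewrite exprn_gt0.
  rewrite [X in _ * X <= _]exprMn mulrA -[leRHS]mul1r ler_wpM2r ?sqr_ge0 //.
  rewrite exprVn ler_pdivrMr ?exprn_gt0 // mul1r.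
  by apply: lerX_sqr; apply: ltW.
have [c [hc hn]] := good w; exists c.
(* The tail of [X *m c] costs at most ll^(2q) K^2 |w|^2, and K <= 2^q turns this into (2 ll)^(2q)
   |w|^2. *)
have res : \sum_(i < d) ll ^+ q ^+ 2 * (V^T *m (G *m c)) i 0 ^+ 2 <= sqnorm v.
  rewrite -mulr_sumr -sqnorm_coord; apply: le_trans sw.
  apply: (@le_trans _ _ (ll ^+ q ^+ 2 * (K%:R ^+ 2 * sqnorm w))).
    by rewrite ler_wpM2l // sqr_ge0.
  rewrite mulrA ler_wpM2r ?sqnorm_ge0 // exprMn [leRHS]exprMn mulrC.
  rewrite ler_wpM2r ?sqr_ge0 // lerXn2r ?nnegrE ?exprn_ge0 // -natrX ler_nat //.
apply: (@le_trans _ _ (\sum_(i < d) (2 * ll * (V^T *m v) i 0 ^+ 2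
   + 2 * ll * (ll ^+ q ^+ 2 * (V^T *m (G *m c)) i 0 ^+ 2)))); last first.
  rewrite big_split /= -!mulr_sumr -sqnorm_coord.
  have := ler_wpM2l (ltW ll2) res; rewrite -mulr_sumr; lra.
rewrite quadform_diag; apply: ler_sum => i _.
set a := (V^T *m v) i 0; set b := (V^T *m (G *m c)) i 0.
have -> : (V^T *m (v - X *m c)) i 0 = a - lm i ^+ q * b.
  by rewrite mulmxBr mxE [X in _ + X]mxE iter_mulmx_vec.
have ll0 := ltW ll_gt0.
have rest : 0 <= 2 * ll * (ll ^+ q ^+ 2 * b ^+ 2).
  by apply: mulr_ge0; [exact: ltW | rewrite mulr_ge0 ?sqr_ge0].
(* For a tail index, (a - z)^2 <= 2 a^2 + 2 z^2 with z the tail of [X *m c]. A top index has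
   residual 0 if matched, and otherwise keeps [a] with eigenvalue at most 2 ll. *)
case: (ltnP i l) => il; last first.
  have hb : (lm i ^+ q * b) ^+ 2 <= ll ^+ q ^+ 2 * b ^+ 2.
    rewrite exprMn ler_wpM2r ?sqr_ge0 //.
    by apply: lerX_sqr; [apply: ltW | apply: lm_bot].
  apply: (@le_trans _ _ (ll * (a - lm i ^+ q * b) ^+ 2)).
    by rewrite ler_wpM2r ?sqr_ge0 // lm_bot.
  rewrite -mulrA -[2 * ll * (_ * _)]mulrA -mulrDr -mulrDr [leRHS]mulrCA ler_wpM2l //.
  have := sqr_ge0 (a + lm i ^+ q * b).
  move: hb; rewrite mulrDr; set u := _ * b; set z := _ * b ^+ 2; nra.
have bE : b = w (Ordinal il) 0.
  have iE : i = widen_ord ld (Ordinal il) by apply: val_inj.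
  by rewrite -hc /b {1}iE -top_rowsE mulmxA.
move: bE; rewrite mxE /=.
have -> : widen_ord ld (Ordinal il) = i by apply: val_inj.
rewrite -/a; case: ltP => h bE.
  have -> : lm i ^+ q * b = a.
    by rewrite bE mulVKf // expf_eq0 gt_eqF // andbF.
  by rewrite subrr expr0n mulr0 addr_ge0 // mulr_ge0 ?sqr_ge0 // ltW.
rewrite bE mulr0 subr0 expr0n /= !mulr0 addr0.
by rewrite ler_wpM2r ?sqr_ge0.
Qed.

End PowerIteration.
End Approximation.

(** * Oracle algorithms and their randomness *)

Section OracleAlgorithms.
Variables (R : realType) (Out : Type) (d : nat).
Local Notation alg := (oracle_alg 'cV[R]_d 'cV[R]_d Out).

Fixpoint ask_all (xs : seq 'cV[R]_d) (k : seq 'cV[R]_d -> alg) : alg :=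
  if xs is x :: xs' then Query x (fun a => ask_all xs' (fun r => k (a :: r)))
  else k [::].

(* [b] is the answer of the oracle at [0]; the continuation receives [A *m X]. *)
Definition ask_mx l (b : 'cV[R]_d) (X : 'M[R]_(d, l)) (k : 'M[R]_(d, l) -> alg) :
    alg :=
  ask_all [seq col j X | j <- enum 'I_l]
    (fun r => k (\matrix_(i, j) (nth 0 r j - b) i 0)).

Fixpoint ask_power l q (b : 'cV[R]_d) (X : 'M[R]_(d, l)) (k : 'M[R]_(d, l) -> alg) :
    alg :=
  if q is q'.+1 then ask_mx b X (fun Y => ask_power q' b Y k) else k X.

Lemma run_ask_all orc xs (k : seq 'cV[R]_d -> alg) :
  run_output orc (ask_all xs k) = run_output orc (k (map orc xs)) /\
  run_calls orc (ask_all xs k) = (size xs + run_calls orc (k (map orc xs)))%N.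
Proof.
elim: xs k => [|x xs ih] k //=.
by have [-> ->] := ih (fun r => k (orc x :: r)).
Qed.

Variables (A : 'M[R]_d) (b : 'cV[R]_d).
Local Notation orc := (grad_oracle A b).

Lemma run_ask_mx l (X : 'M[R]_(d, l)) (k : 'M[R]_(d, l) -> alg) :
  run_output orc (ask_mx b X k) = run_output orc (k (A *m X)) /\
  run_calls orc (ask_mx b X k) = (l + run_calls orc (k (A *m X)))%N.
Proof.
have [ho hc] := run_ask_all orc [seq col j X | j <- enum 'I_l]
  (fun r => k (\matrix_(i, j) (nth 0 r j - b) i 0)).
move: ho hc; rewrite -/(ask_mx b X k) size_map size_enum_ord.
suff -> : (\matrix_(i, j)
  (nth 0 [seq orc i0 | i0 <- [seq col j0 X | j0 <- enum 'I_l]] j - b) i 0)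
  = A *m X by [].
apply/matrixP => i j; rewrite mxE -map_comp (nth_map j) ?size_enum_ord //=.
by rewrite nth_ord_enum /grad_oracle addrK colE mulmxA -colE mxE.
Qed.

Lemma run_ask_power l q (X : 'M[R]_(d, l)) (k : 'M[R]_(d, l) -> alg) :
  run_output orc (ask_power q b X k) =
    run_output orc (k (iter q (mulmx A) X)) /\
  run_calls orc (ask_power q b X k) =
    (q * l + run_calls orc (k (iter q (mulmx A) X)))%N.
Proof.
elim: q X => [//|q ih] X; rewrite /= -/(ask_mx _ _ _).
have [-> ->] := run_ask_mx X (fun Y => ask_power q b Y k).
have [-> ->] := ih (A *m X); rewrite -iterSr iterS.
by rewrite mulSn addnA.
Qed.
End OracleAlgorithms.

(** * The uniform law on a finite type *)

Section UniformProbability.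
Local Open Scope classical_set_scope.
Local Open Scope ring_scope.

(** The seed is an index into [enum T], drawn from the normalized sum of the Dirac masses at the
    first [#|T|] integers. *)
Lemma uniform_probability (R : realType) (T : finType) (x0 : T) :
  exists P : probability nat R, forall B : {set T},
    P [set w | nth x0 (enum T) w \notin B] = (1 - #|B|%:R / #|T|%:R)%:E.
Proof.
pose mu : {measure set nat -> \bar R} := msum (fun k : nat => \d_k) #|T|.
have muE (S : set nat) : mu S = (\sum_(k < #|T|) \1_S (k : nat))%:E.
  by rewrite /mu /= /msum -sumEFin.
have T0 : (0 < #|T|)%N by apply/card_gt0P; exists x0.
have muT : mu setT = (#|T|%:R)%:E.
  rewrite muE; congr (_%:E); under eq_bigr do rewrite indicT.
  by rewrite sumr_const card_ord.
(* The Dirac mass at 0 is only the default of the normalization; the total mass here is [#|T|],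
   finite and nonzero. *)
exists (mnormalize mu (\d_0%N : probability nat R)) => B.
rewrite /= /mnormalize muT eqe pnatr_eq0 gtn_eqF //= muE -EFinM; congr (_%:E).
have Tn0 : #|T|%:R != 0 :> R by rewrite pnatr_eq0 -lt0n.
suff -> : \sum_(k < #|T|) \1_[set w | nth x0 (enum T) w \notin B] (k : nat)
    = #|T|%:R - #|B|%:R :> R by field.
have -> : #|T|%:R - #|B|%:R = #|finset.setC B|%:R :> R.
  by rewrite -(cardsC B) natrD addrAC subrr add0r.
transitivity (\sum_(k < #|T|) (enum_val k \in finset.setC B)%:R : R).
  apply: eq_bigr => k _; rewrite indicE; congr (_%:R); congr nat_of_bool.
  by apply/idP/idP; rewrite finset.in_setC in_setE /= (enum_val_nth x0).
rewrite -(big_enum_val (fun x => (x \in finset.setC B)%:R)) /=.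
rewrite -sum1_card natr_sum [RHS]big_mkcond /=.
by apply: eq_big => // x _; case: ifP => // ->.
Qed.

End UniformProbability.

(** * The theorem *)

Section MainTheorem.
Variable R : realType.

Lemma posdef_eigenvalues d (A : 'M[R]_d) lam :
    posdefmx A -> sorted_eigenvalues A lam ->
  exists V : 'M[R]_d, [/\ V^T *m V = 1%:M,
    A = V *m diag_mx (\row_i lam`_i) *m V^T,
    forall i : 'I_d, 0 < lam`_i &
    forall i j : 'I_d, (i <= j)%N -> lam`_j <= lam`_i].
Proof.
move=> [/symmetricmxP sA pA] [slam cA].
have [V [VV AE]] := spectral_theorem sA cA; exists V; split=> // [i|i j ij].
  have := pA (col i V); rewrite (quadform_diag AE) colE mulmxA VV mul1mx.
  rewrite (bigD1 i) //= big1 ?addr0 => [|j ji]; last first.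
    by rewrite mxE (negPf ji) expr0n mulr0.
  rewrite mxE !eqxx expr1n mulr1; apply.
  apply/eqP => V0; move/matrixP/(_ i 0): (congr1 (mulmx V^T) V0).
  by rewrite mulmxA VV mul1mx mulmx0 !mxE !eqxx; apply/eqP; rewrite oner_eq0.
have sz : size lam = d.
  by apply: succn_inj; rewrite -(size_prod_XsubC lam idfun) -cA size_char_poly.
have tr : transitive (fun a b : R => b <= a) by move=> x y z xy yz; apply: le_trans yz xy.
have rf : reflexive (fun a b : R => b <= a) by move=> x /=.
by apply: (sorted_leq_nth tr rf 0 slam) => //; rewrite inE sz.
Qed.

(** The deterministic half: randomness enters only through the conditioning of [U *m G], and [U]
    depends on [A] alone, so the law of [G] can be fixed before [A] is known. *)
Lemma power_iteration_error d l (ld : (l.+1 <= d)%N) (A : 'M[R]_d) lam :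
    posdefmx A -> sorted_eigenvalues A lam ->
  exists U : 'M[R]_(l.+1, d), U *m U^T = 1%:M /\
  forall q K (G : 'M[R]_(d, l.+1)), (K <= 2 ^ q)%N ->
    (forall w : 'cV[R]_l.+1, exists c : 'cV[R]_l.+1,
      U *m G *m c = w /\ sqnorm (G *m c) <= K%:R ^+ 2 * sqnorm w) ->
  let X := iter q (mulmx A) G in let A1 := shifted_nystrom X (A *m X) in
  [/\ A1^T = A1, loewner_ge (A - A1) (eig lam d / 2)%:M &
      spectral_norm (A - A1) <= 5 * eig lam l.+1].
Proof.
move=> pdA eA; have [V [VV AE lam0 lamS]] := posdef_eigenvalues pdA eA.
have sA : A^T = A by apply/symmetricmxP; case: pdA.
have dd : (d.-1 < d)%N by rewrite prednK // (leq_trans _ ld).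
(* Indices start at 0, so the last of the [l.+1] top eigenvalues is [eig lam l.+1]. *)
pose i0 : 'I_l.+1 := ord_max.
pose ll := lam`_l; pose mu := lam`_d.-1.
have ll0 : 0 < ll := lam0 (widen_ord ld i0).
have mu0 : 0 < mu := lam0 (Ordinal dd).
have bot (i : 'I_d) : (l.+1 <= i)%N -> lam`_i <= ll.
  by move=> li; apply: (lamS (widen_ord ld i0)) => /=; apply: ltnW.
exists (top_rows V ld); split; first exact: top_rows_isometry.
move=> q K G Kq good X A1.
have hmu x : mu * sqnorm x <= quadform A x.
  rewrite (quadform_diag AE) (sqnorm_coord VV) mulr_sumr.
  apply: ler_sum => i _; rewrite ler_wpM2r ?sqr_ge0 //.
  by apply: (lamS i (Ordinal dd)) => /=; rewrite -ltnS prednK // (leq_trans _ ld).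
have [ET Elo Eup] := shifted_nystrom_bounds sA mu0 hmu
  (power_iteration_inj VV AE lam0 good)
  (power_iteration_ritz VV AE bot q good (erefl : lam`_(widen_ord ld i0) = ll))
  (power_iteration_approx VV AE lam0 ll0 bot Kq good).
have sA1 : A1^T = A1.
  have : (A - (A - A1))^T = A - (A - A1) by rewrite linearB /= ET sA.
  by rewrite subKr.
split=> //.
  split=> [|x].
    by apply/symmetricmxP; rewrite linearB /= ET tr_scalar_mx.
  rewrite quadformB quadform_scalar subr_ge0; apply: le_trans (Elo x).
  rewrite ler_wpM2r ?sqnorm_ge0 // /eig -/mu ler_pdivrMr //; move: mu0; lra.
apply: spectral_norm_le => // [x|].
  by apply: le_trans (Elo x); rewrite mulr_ge0 ?sqnorm_ge0 // ltW.
by rewrite mulr_ge0 // ltW.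
Qed.

Lemma logfactor_ge1 d (p : R) lam : (0 < d)%N -> 0 < p < 1 ->
    0 < eig lam d -> eig lam d <= eig lam 1 ->
  1 + ln d%:R + ln p^-1 <= logfactor d p lam.
Proof.
move=> d0 p01 e0 e1; rewrite /logfactor lerDl ln_ge0 //.
by rewrite ler_pdivlMr // mul1r.
Qed.

(** Since l <= d and N + 1 <= 2 d / p, the argument is at most 4 d^3 / p. The factor 3 comes from
    the cube and from ln 4 <= 3, an instance of ln (1 + x) <= x. *)
Lemma trunc_log_le d l N (p : R) : (0 < l)%N -> (l <= d)%N -> 0 < p < 1 ->
    N%:R <= l%:R / p ->
  ((trunc_log 2 (2 * d * l * N.+1))%:R : R) <=
    3 / ln 2 * (1 + ln d%:R + ln p^-1).
Proof.
move=> l0 ld /andP[p0 p1] Np.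
have d1 : 1 <= d%:R :> R by rewrite ler1n (leq_trans l0).
have d0 : 0 < d%:R :> R by apply: lt_le_trans d1.
have ip : 1 <= p^-1 by rewrite invf_ge1 // ltW.
have ip0 : 0 < p^-1 by rewrite invr_gt0.
have l2 : 0 < ln 2 :> R by rewrite ln_gt0 // ltr1n.
set K := (2 * d * l * N.+1)%N.
have K0 : (0 < K)%N by rewrite !muln_gt0 l0 (leq_trans l0 ld).
rewrite mulrAC ler_pdivlMr // mulr_natl -lnXn //.
apply: (@le_trans _ _ (ln K%:R)).
  by rewrite ler_ln ?posrE ?exprn_gt0 ?ltr0n // -natrX ler_nat trunc_logP.
have KE : K%:R <= 4 * d%:R ^+ 3 * p^-1.
  have ldr : l%:R <= d%:R :> R by rewrite ler_nat.
  have N1 : N.+1%:R <= 2 * (d%:R * p^-1).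
    have dp : 1 <= d%:R * p^-1 by rewrite -[leLHS]mulr1 ler_pM.
    have : l%:R / p <= d%:R / p by rewrite ler_wpM2r // ltW.
    rewrite -natr1; move: Np; lra.
  rewrite /K !natrM.
  have -> : 4 * d%:R ^+ 3 * p^-1 = 2 * d%:R * d%:R * (2 * (d%:R * p^-1)) :> R by ring.
  by rewrite ler_pM // ?mulr_ge0 // ler_wpM2l // mulr_ge0.
apply: (@le_trans _ _ (ln (4 * d%:R ^+ 3 * p^-1))).
  rewrite ler_ln ?posrE ?ltr0n //.
  by rewrite !mulr_gt0 // exprn_gt0.
rewrite lnM ?posrE ?mulr_gt0 ?exprn_gt0 // lnM ?posrE ?exprn_gt0 //.
have -> : ln (d%:R ^+ 3) = 3 * ln d%:R :> R by rewrite lnXn // mulr_natl.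
have : ln 4 <= 3 :> R.
  by have := @le_ln1Dx R 3; rewrite (_ : 1 + 3 = 4 :> R); [apply; lra | ring].
have : 0 <= ln p^-1 by rewrite ln_ge0.
lra.
Qed.

End MainTheorem.

Theorem theorem1 (R : realType) :
  exists (C : R) (k : nat),
  forall (d l : nat) (p : R), (0 < l)%N -> (l <= d)%N -> 0 < p < 1 ->
  exists alg : rand_alg R 'cV[R]_d 'cV[R]_d (seq (R * 'cV[R]_d)),
  forall (A : 'M[R]_d) (b : 'cV[R]_d) (lam : seq R),
    posdefmx A -> sorted_eigenvalues A lam ->
    succeeds_whp alg p (grad_oracle A b)
      (fun (s : seq (R * 'cV[R]_d)) (calls : nat) =>
         let A1 := rank1_sum s in
         let polylog := logfactor d p lam ^+ k in
         [/\ calls%:R <= C * l%:R * polylog,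
             \rank A1 = size s /\ (size s)%:R <= C * l%:R * polylog,
             loewner_ge (A - A1) (eig lam d / 2)%:M &
             spectral_norm (A - A1) <= C * eig lam l]).
Proof.
(* The first summand pays for the power iterations; 5 is the spectral norm constant and also covers
   the remaining oracle calls and the rank. *)
exists (3 / ln 2 + 5), 1%N => d [//|l] p l0 ld p01.
have d0 := leq_trans l0 ld.
have [p0 p1] := andP p01.
(* The entries of [G] take N + 1 > l / p values, so the union bound over the columns fails with
   probability at most [p]. [K] is the resulting conditioning bound, and the successor in [q]
   ensures K <= 2^q. *)
pose N := Num.truncn (l.+1%:R / p : R).
pose K := (2 * d * l.+1 * N.+1)%N; pose q := (trunc_log 2 K).+1.
(* The strategy must be a function, so a decomposition is chosen once for every matrix, the empty
   list serving for the non-symmetric ones. *)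
have [f hf] : exists f : 'M[R]_d -> seq (R * 'cV[R]_d), forall M, M^T = M ->
    rank1_sum (f M) = M /\ size (f M) = \rank M.
  have /boolp.choice[f hf] (M : 'M[R]_d) : exists s : seq (R * 'cV[R]_d), M^T = M ->
      rank1_sum s = M /\ size s = \rank M.
    have [/rank1_decomposition[s hs]|nM] := pselect (M^T = M); first by exists s.
    by exists [::].
  by exists f.
pose T := {ffun 'I_d * 'I_l.+1 -> 'I_N.+1}.
pose G0 : T := [ffun=> ord0].
have [P hP] := uniform_probability R G0.
(* The query at 0 reveals [b], which is then subtracted from later answers. The last product
   [A *m X] supplies the second argument of [shifted_nystrom]. *)
pose strategy (w : nat) := let G := natmx R (nth G0 (enum T) w) in
  Query 0 (fun b => ask_power q b G (fun X => ask_mx b X (fun Y =>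
    Return 'cV[R]_d 'cV[R]_d (f (shifted_nystrom X Y))))).
exists (RandAlg P strategy) => A b lam pdA eA.
have [V [_ _ lam0 lamS]] := posdef_eigenvalues pdA eA.
have dd : (d.-1 < d)%N by rewrite prednK.
set L := 1 + ln d%:R + ln p^-1.
have L1 : L <= logfactor d p lam.
  by apply: logfactor_ge1 => //; [exact: (lam0 (Ordinal dd)) |
    exact: (lamS (Ordinal d0) (Ordinal dd))].
have L0 : 1 <= L.
  by rewrite /L -addrA lerDl addr_ge0 ?ln_ge0 ?ler1n // invf_ge1 // ltW.
have lp : 0 <= l.+1%:R / p by rewrite divr_ge0 // ltW.
have qL : (trunc_log 2 K)%:R <= 3 / ln 2 * L.
  by apply: trunc_log_le => //; rewrite truncn_le.
have ln2 : 0 < ln 2 :> R by rewrite ln_gt0 // ltr1n.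
have c0 : 0 < 3 / ln 2 :> R by rewrite divr_gt0.
have [U [UU err]] := power_iteration_error ld pdA eA.
have [B [cardB goodB]] := random_cols_well_conditioned N.+1 UU.
exists [set w | nth G0 (enum T) w \notin B]%classic; split => //=.
  rewrite hP lee_fin lerD2l lerN2.
  have T0 : (0 < #|T|)%N by apply/card_gt0P; exists G0.
  rewrite ler_pdivrMr ?ltr0n //.
  have N0 : 0 < N.+1%:R :> R by rewrite ltr0n.
  rewrite -(ler_pM2r N0) -natrM.
  apply: (@le_trans _ _ (l.+1 * #|T|)%:R); first by rewrite ler_nat.
  rewrite natrM mulrAC ler_wpM2r // mulrC -ler_pdivrMr //.
  by apply: ltW; apply: truncnS_gt.
move=> w /= wB; set G := natmx R _.
have Kq : (K <= 2 ^ q)%N by apply/ltnW/trunc_log_ltn.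
have [sA1 lo up] := err q K G Kq (goodB _ wB).
have bE : grad_oracle A b 0 = b by rewrite /grad_oracle mulmx0 add0r.
rewrite bE.
have [-> ->] := run_ask_power A b q G (fun X => ask_mx b X (fun Y =>
    Return 'cV[R]_d 'cV[R]_d (f (shifted_nystrom X Y)))).
set X := iter q (mulmx A) G in sA1 lo up *.
have [-> ->] := run_ask_mx A b X (fun Y =>
    Return 'cV[R]_d 'cV[R]_d (f (shifted_nystrom X Y))).
rewrite /=; have [-> sz] := hf _ sA1.
have l1 : 1 <= l.+1%:R :> R by rewrite ler1n.
have ll : 0 < eig lam l.+1 := lam0 (Ordinal ld).
(* One bound for both counts: with l columns there are 1 + q l + l calls, where q is the truncated
   logarithm plus 1, and the rank is at most 2 l. *)
have size_le : (3 / ln 2 * L + 3) * l.+1%:R <=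
    (3 / ln 2 + 5) * l.+1%:R * logfactor d p lam ^+ 1.
  rewrite expr1 [leRHS]mulrAC ler_wpM2r //.
  apply: (@le_trans _ _ ((3 / ln 2 + 5) * L)); last first.
    by rewrite ler_wpM2l // addr_ge0 // ltW.
  rewrite [leRHS]mulrDl lerD2l; move: L0; lra.
split => //.
- apply: le_trans size_le.
  rewrite addn0 -addSn addSn -[X in X%:R]addn1 /q !natrD natrM -natr1.
  have := ler_wpM2r (ler0n R l.+1) qL; nra.
- rewrite sz; split=> //; apply: le_trans size_le.
  apply: (@le_trans _ _ (2 * l.+1)%:R); first by rewrite ler_nat rank_shifted_nystrom.
  rewrite natrM ler_wpM2r //.
  have : 0 <= 3 / ln 2 * L by rewrite mulr_ge0 ?ltW // (lt_le_trans ltr01).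
  lra.
- apply: (le_trans up); rewrite ler_wpM2r ?ltW //; move: c0; lra.
Qed.
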